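(* For every integer $n\geq2$, $$\Gamma_{2^n}(B_1^n)\leq\frac56 .$$
   Context: For a convex body $K\subset\mathbb{R}^n$ (compact convex set with nonempty interior) and an integer $m\geq1$, $$\Gamma_m(K)=\inf\Big\{\gamma>0:\ \exists\, c_1,\ldots,c_m\in\mathbb{R}^n\ \text{such that}\ K\subseteq\bigcup_{i=1}^m(c_i+\gamma K)\Big\}.$$ $B_1^n=\{x\in\mathbb{R}^n:\ \|x\|_1\leq1\}$, where $\|x\|_1=\sum_{i=1}^n|x_i|$. *)

(* Defs.v *)
From HB Require Import structures.
From mathcomp Require Import all_boot all_order all_algebra.
From mathcomp Require Import all_classical all_reals.

Set Implicit Arguments.
Unset Strict Implicit.
Unset Printing Implicit Defensive.
Import Order.TTheory GRing.Theory Num.Theory.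
Local Open Scope classical_set_scope.
Local Open Scope ring_scope.

Definition l1norm (R : realType) (n : nat) (x : 'rV[R]_n) : R :=
  \sum_(i < n) `|x 0 i|.

Definition cross_polytope (R : realType) (n : nat) : set 'rV[R]_n :=
  [set x | l1norm x <= 1].

Definition homothet (R : realType) (n : nat) (c : 'rV[R]_n) (g : R)
    (K : set 'rV[R]_n) : set 'rV[R]_n :=
  [set c + g *: x | x in K].

Definition covering_ratios (R : realType) (n m : nat) (K : set 'rV[R]_n) :
    set R :=
  [set g | 0 < g /\ exists c : 'I_m -> 'rV[R]_n,
     K `<=` \bigcup_(i in [set: 'I_m]) homothet (c i) g K].

(* [inf] takes the junk value 0 on the empty set; [covering_ratios_has_inf]
   shows that this never happens when m >= 1. *)
Definition covering_functional (R : realType) (n m : nat)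
    (K : set 'rV[R]_n) : R :=
  inf (covering_ratios m K).

Lemma covering_ratios_has_inf (R : realType) (n m : nat) (K : set 'rV[R]_n) :
  (0 < m)%N -> has_inf (covering_ratios m K).
Proof.
case: m => // m _; split.
  exists 1; split; first exact: ltr01.
  exists (fun=> 0) => x Kx; exists ord0 => //.
  by exists x => //; rewrite add0r scale1r.
by exists 0 => g [g0 _]; exact: ltW.
Qed.

(* Main.v *)
(* Put k = ceil((n - 1) / 5) and take as centers the points z / (6 k), with z an
   integer vector such that |z|_1 <= k and |z|_1 = k mod 2.

   Covering: moving w by a unit in its largest coordinate turns |w|_1 into at
   most max(|w|_1 - 1, n - 1). Starting from y = 6 k x, where |y|_1 <= 6 k, k
   such moves lead to |y - z|_1 <= max(5 k, n - 1) = 5 k, and the sum z of the k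
   signed unit vectors that were used has the required norm and parity.

   Counting: the number E(n, k) of such z satisfies the Delannoy recursion
   E(n+1, k+1) = E(n, k+1) + E(n+1, k) + E(n, k), whence
   E(n, k) <= (11/9)^(n-5) 10^k for n >= 5. This is at most 2^n as soon as
   n >= 12; the remaining dimensions are checked by computation. *)
Require Import Defs.
From mathcomp Require Import all_boot all_order all_algebra.
From mathcomp Require Import all_classical all_reals.
From mathcomp Require Import zify ring lra.
Import Order.TTheory GRing.Theory Num.Theory.
Local Open Scope ring_scope.

Set Implicit Arguments.
Unset Strict Implicit.

(* The cardinal of [parity_ball k] in dimension n, see [parity_ball_enum]. *)
Fixpoint parity_ball_card (n k : nat) : nat :=
  if n isn't n'.+1 then (~~ odd k : nat) else
  (fix aux k := if k isn't k'.+1 then 1%N else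
     (parity_ball_card n' k + aux k' + parity_ball_card n' k')%N) k.

Lemma parity_ball_cardSS n k :
  parity_ball_card n.+1 k.+1 =
  (parity_ball_card n k.+1 + parity_ball_card n.+1 k + parity_ball_card n k)%N.
Proof. by []. Qed.

Lemma parity_ball_card0 n : parity_ball_card n 0 = 1%N.
Proof. by case: n. Qed.

Lemma parity_ball_card_row1 k : parity_ball_card 1 k = k.+1.
Proof.
elim: k => // k IH; rewrite parity_ball_cardSS IH /=.
by case: (odd k) => /=; lia.
Qed.

Lemma parity_ball_card_col1 n : parity_ball_card n 1 = (2 * n)%N.
Proof.
by elim: n => // n IH; rewrite parity_ball_cardSS IH !parity_ball_card0; lia.
Qed.

(** Equality at [k = 0]. From dimension n+1 to n+2 the recursion closes when 10(n+1) + (n+2) + (n+1)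
    <= 10(n+2), that is for n <= 3. In dimension 5 the bound reads 10^(k+1). *)
Lemma parity_ball_card_le5 n k : (n < 5)%N ->
  (parity_ball_card n.+1 k.+1 <= 2 * n.+1 * 10 ^ k)%N.
Proof.
elim: n k => [|n IHn] k n5.
  rewrite parity_ball_card_row1; elim: k => // k IHk; rewrite expnS; nia.
elim: k => [|k IHk]; first by rewrite parity_ball_card_col1 muln1.
rewrite parity_ball_cardSS.
have := IHn k.+1 (ltnW n5); have := IHn k (ltnW n5).
rewrite expnS; nia.
Qed.

(* The weights are fixed points of the recursion: 9 * 10 + 11 + 9 = 11 * 10. *)
Lemma parity_ball_card_exp m k :
  (9 ^ m * parity_ball_card (5 + m) k <= 11 ^ m * 10 ^ k)%N.
Proof.
elim: m k => [|m IHm] k.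
  case: k => [|k]; first by rewrite parity_ball_card0.
  by rewrite addn0 !mul1n expnS; exact: parity_ball_card_le5.
elim: k => [|k IHk].
  by rewrite parity_ball_card0 !muln1 leq_exp2r.
rewrite addnS parity_ball_cardSS.
have := IHm k.+1; have := IHm k; move: IHk.
rewrite addnS !expnS; nia.
Qed.

Lemma parity_ball_card_le_exp2 n : (2 <= n)%N ->
  (parity_ball_card n ((n + 3) %/ 5) <= 2 ^ n)%N.
Proof.
move=> n2; have [n12|n12] := ltnP n 12.
  by do 12 (case: n n2 n12 => [|n] n2 n12 //; try by vm_compute).
set k := (_ %/ _)%N.
(* As 5k - 3 <= n, one can write n = 12 + 5l + j. The bound then splits into a constant factor, an
   l-th power resting on 11^5 * 10 <= 18^5, and a j-th power resting on 11 <= 18. *)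
have [l kE] : exists l, k = (3 + l)%N by exists (k - 3)%N; rewrite /k; lia.
have [j nE] : exists j, n = (5 + (7 + l * 5 + j))%N.
  by exists (n - (12 + l * 5))%N; move: kE; rewrite /k; lia.
rewrite nE kE; set m := (7 + l * 5 + j)%N.
have := parity_ball_card_exp m (3 + l).
rewrite -(@leq_pmul2l (9 ^ m) _ (2 ^ _)) ?expn_gt0 // => /leq_trans; apply.
rewrite [(2 ^ _)%N]expnD mulnCA -expnMn /m !expnD !expnM.
have leq_exp e a b : (a <= b -> a ^ e <= b ^ e)%N.
  by case: e => // e ab; rewrite leq_exp2r.
have b3 : (11 ^ j <= (9 * 2) ^ j)%N by apply: leq_exp.
have b2 : ((11 ^ l) ^ 5 * 10 ^ l <= ((9 * 2) ^ l) ^ 5)%N.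
  by rewrite -!expnM ![(l * 5)%N]mulnC !expnM -expnMn; apply: leq_exp; lia.
have b1 : (11 ^ 7 * 10 ^ 3 <= 2 ^ 5 * (9 * 2) ^ 7)%N by lia.
have := leq_mul (leq_mul b1 b2) b3.
move: (11 ^ 7)%N (10 ^ 3)%N ((9 * 2) ^ 7)%N (2 ^ 5)%N => A B C D.
move: (11 ^ l)%N (10 ^ l)%N ((9 * 2) ^ l)%N => a b c.
move: (11 ^ j)%N ((9 * 2) ^ j)%N => d e.
by congr (_ <= _)%N; ring.
Qed.

Definition signed_unit {R : pzRingType} {n} (i : 'I_n) (b : bool) : 'rV[R]_n :=
  (-1) ^+ b *: delta_mx 0 i.

Lemma l1normZ (R : realType) n a (x : 'rV[R]_n) :
  l1norm (a *: x) = `|a| * l1norm x.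
Proof. by rewrite mulr_sumr; apply: eq_bigr => i _; rewrite mxE normrM. Qed.

(** Let t be the largest absolute value of a coordinate. If t >= 1, the move lowers the norm by 1.
    Otherwise the new norm is at most (1 - t) + (n+1)t = 1 + nt <= n+1. *)
Lemma l1norm_step (R : realType) n (w : 'rV[R]_n.+2) :
  exists i b, l1norm (w - signed_unit i b) <= Num.max (l1norm w - 1) n.+1%:R.
Proof.
pose i := [arg max_(i > ord0) `|w 0 i|]%O.
have wi j : `|w 0 j| <= `|w 0 i|.
  by rewrite /i; case: arg_maxP => // i0 _ /(_ j isT).
exists i, (w 0 i < 0).
pose rest := \sum_(j < n.+2 | j != i) `|w 0 j|.
have -> : l1norm w = `|w 0 i| + rest by rewrite /l1norm (bigD1 i).
have -> : l1norm (w - signed_unit i (w 0 i < 0)) = `| `|w 0 i| - 1| + rest.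
  rewrite /l1norm (bigD1 i) //=; congr (_ + _).
    rewrite !mxE !eqxx mulr1; case: ltP => w0 /=.
      by rewrite (ltr0_norm w0) -normrN; congr `|_|; lra.
    by rewrite (ger0_norm w0).
  by apply: eq_bigr => j /negPf ji; rewrite !mxE ji andbF mulr0 subr0.
have restE : rest <= n.+1%:R * `|w 0 i|.
  rewrite mulr_natl; apply: le_trans (ler_sum _ (fun j _ => wi j)) _.
  by rewrite sumr_const cardC1 card_ord.
rewrite le_max; have [f1|f1] := lerP 1 `|w 0 i|.
  by rewrite addrAC lexx.
apply/orP; right.
have : n%:R * `|w 0 i| <= n%:R by rewrite ler_piMr // ltW.
by move: restE; rewrite -natr1; lra.
Qed.

Definition l1normz {n} (z : 'rV[int]_n) : nat := (\sum_i `|z ord0 i|)%N.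

Lemma l1normz_eq0 n (z : 'rV[int]_n) : (l1normz z == 0%N) = (z == 0).
Proof.
rewrite /l1normz sum_nat_eq0; apply/forallP/eqP => [z0|-> i]; last first.
  by rewrite mxE.
by apply/rowP => i; rewrite mxE; apply/eqP; rewrite -absz_eq0; exact: z0.
Qed.

Lemma l1normz_row_mx n a (p : 'rV[int]_n) :
  l1normz (row_mx a%:M p : 'rV_n.+1) = (`|a| + l1normz p)%N.
Proof.
rewrite /l1normz big_ord_recl; congr (_ + _)%N.
  rewrite (_ : ord0 = @lshift 1 n ord0); last exact: val_inj.
  by rewrite (@row_mxEl _ 1 1 n) mxE.
apply: eq_bigr => i _; rewrite (_ : lift ord0 i = rshift 1 i) ?(@row_mxEr _ 1 1 n) //.
exact: val_inj.
Qed.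

Definition parity_ball {n} (k : nat) (z : 'rV[int]_n) : bool :=
  (l1normz z <= k)%N && (odd (l1normz z) == odd k).

Lemma parity_ball_step n k (z : 'rV[int]_n) i b :
  parity_ball k z -> parity_ball k.+1 (z + signed_unit i b).
Proof.
rewrite /parity_ball /l1normz (bigD1 i) //= [in X in _ -> X](bigD1 i) //=.
rewrite [X in (_ + X <= k.+1)%N](eq_bigr (fun j => `|z ord0 j|%N)); last first.
  by move=> j /negPf ji; rewrite !mxE ji andbF mulr0 addr0.
rewrite [X in odd (_ + X) == ~~ _](eq_bigr (fun j => `|z ord0 j|%N)); last first.
  by move=> j /negPf ji; rewrite !mxE ji andbF mulr0 addr0.
rewrite !mxE !eqxx mulr1.
case: b => /=; rewrite ?expr1 ?expr0; lia.
Qed.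

Lemma integer_approximation (R : realType) n k (y : 'rV[R]_n.+2) :
  exists2 z : 'rV[int]_n.+2, parity_ball k z &
    l1norm (y - map_mx intr z) <= Num.max (l1norm y - k%:R) n.+1%:R.
Proof.
elim: k => [|k [z zk IH]].
  exists 0; last by rewrite map_mx0 !subr0 le_max lexx.
  by rewrite /parity_ball /l1normz big1 // => i _; rewrite mxE.
have [i [b step]] := l1norm_step (y - map_mx intr z).
exists (z + signed_unit i b); first exact: parity_ball_step.
rewrite map_mxD map_mxZ map_delta_mx rmorphXn rmorphN1 opprD addrA.
apply: le_trans step _; rewrite ge_max; apply/andP; split.
  rewrite lerBlDr; apply: le_trans IH _; rewrite ge_max.
  by apply/andP; split; rewrite -lerBlDr le_max; apply/orP; [left|right];
    rewrite -?[k.+1%:R]natr1; lra.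
by rewrite le_max lexx orbT.
Qed.

Lemma parity_ball_enum n k :
  exists2 s : seq 'rV[int]_n, size s = parity_ball_card n k &
    forall z, parity_ball k z -> z \in s.
Proof.
have zero m : exists2 s : seq 'rV[int]_m, size s = 1%N &
    forall z, parity_ball 0 z -> z \in s.
  by exists [:: 0] => // z; rewrite /parity_ball leqn0 l1normz_eq0 inE => /andP[].
elim: n k => [|n IHn] k.
  exists (if odd k then [::] else [:: 0]) => [|z]; first by rewrite /=; case: odd.
  have -> : z = 0 by apply/rowP => -[].
  rewrite /parity_ball (eqP (_ : l1normz 0 == 0%N)) ?l1normz_eq0 //=.
  by case: odd; rewrite ?inE.
elim: k => [|k [s2 sz2 s2P]]; first by rewrite parity_ball_card0; exact: zero.
(* A vector with first coordinate neither 0 nor -1 is obtained by moving the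
   first coordinate of a point of the ball of radius k away from 0; since 0
   moves to 1, the value -1 has to be supplied separately. *)
have [s1 sz1 s1P] := IHn k.+1; have [s3 sz3 s3P] := IHn k.
pose away (z : 'rV[int]_(1 + n)) : 'rV[int]_(1 + n) :=
  let a := lsubmx z 0 0 in
  row_mx (if 0 <= a then a + 1 else a - 1)%:M (rsubmx z).
exists ([seq row_mx 0%:M p : 'rV_(1 + n) | p <- s1] ++ [seq away z | z <- s2] ++
        [seq row_mx (-1)%:M p : 'rV_(1 + n) | p <- s3]) => [|z].
  by rewrite !size_cat !size_map sz1 sz2 sz3 addnA.
have [a [p ->]] : exists a p, z = row_mx a%:M p :> 'rV_(1 + n).
  exists (lsubmx (z : 'rV_(1 + n)) 0 0), (rsubmx (z : 'rV_(1 + n))).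
  by rewrite -mx11_scalar hsubmxK.
rewrite /parity_ball l1normz_row_mx !mem_cat => zk.
have [a0|a0] := eqVneq a 0.
  apply/orP; left; rewrite a0; apply: map_f; apply: s1P.
  by rewrite a0 in zk.
apply/orP; right; have [a1|a1] := eqVneq a (-1).
  apply/orP; right; rewrite a1; apply: map_f; apply: s3P.
  by move: zk; rewrite a1 /parity_ball /=; lia.
apply/orP; left; apply/mapP.
(* The first coordinate moves towards 0. Here a >= 1 gives a - 1 >= 0 and a <= -2 gives a + 1 < 0,
   so [away] takes the same branch and undoes the move. *)
exists (row_mx (if 0 <= a then a - 1 else a + 1)%:M p : 'rV_(1 + n)).
  by apply: s2P; rewrite /parity_ball l1normz_row_mx; case: ifP => ?; lia.
rewrite /away row_mxKl row_mxKr mxE eqxx mulr1n; congr (row_mx _%:M _).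
by case: (lerP 0 a) => ?; case: ifP => ?; lia.
Qed.

Theorem theorem1p2 (R : realType) (n : nat) (hn : (2 <= n)%N) :
  covering_functional (2 ^ n) (@cross_polytope R n) <= 5%:R / 6%:R.
Proof.
case: n hn => [//|[//|n]] hn.
have [_ lb] := covering_ratios_has_inf (@cross_polytope R n.+2) (expn_gt0 2 n.+2).
apply: (ge_inf lb); split; first by rewrite divr_gt0.
have card_le := parity_ball_card_le_exp2 hn; set k := (_ %/ _)%N in card_le.
have [s sz sP] := parity_ball_enum n.+2 k.
have k0 : (0 < k)%N by rewrite /k; lia.
have k5 : (n.+1 <= 5 * k)%N by rewrite /k; lia.
clearbody k.
have kR : 0 < k%:R :> R by rewrite ltr0n.
(* [s] may have fewer than 2^(n+2) entries; the default of [nth] fills the remaining indices with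
   the center 0. *)
exists (fun i => (6 * k%:R)^-1 *: map_mx intr (nth 0 s i)) => x x1.
have [z zk near] := integer_approximation k ((6 * k%:R) *: x).
have zs := sP z zk.
have iz : (index z s < 2 ^ n.+2)%N.
  by apply: leq_trans card_le; rewrite -sz index_mem.
exists (Ordinal iz) => //=; rewrite nth_index //.
(* With y = 6kx, this solves x = z/(6k) + (5/6)u for u = (y - z)/(5k). *)
exists ((5 * k%:R)^-1 *: ((6 * k%:R) *: x - map_mx intr z)); last first.
  have -> : 5%:R / 6%:R = (6 * k%:R)^-1 * (5 * k%:R) :> R by field; exact: lt0r_neq0.
  have k6 : 6 * k%:R != 0 :> R by rewrite mulf_neq0 // lt0r_neq0.
  rewrite scalerA mulfK ?mulf_neq0 ?lt0r_neq0 //.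
  by rewrite scalerBr scalerA mulVf // scale1r addrC subrK.
rewrite /cross_polytope /= l1normZ ger0_norm ?invr_ge0 ?mulr_ge0 ?ler0n //.
rewrite mulrC ler_pdivrMr ?mul1r; last lra.
apply: le_trans near _; rewrite ge_max; apply/andP; split.
  rewrite l1normZ ger0_norm ?mulr_ge0 ?ler0n //.
  have : 6 * k%:R * l1norm x <= 6 * k%:R by rewrite ler_piMr // mulr_ge0 ?ler0n.
  lra.
by rewrite -natrM ler_nat.
Qed.
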